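(* Let $\nu>0$ and $c\in\mathbb{R}$. Suppose $[\mathcal{D}_x]$ is $P_1$-th order accurate, $[\mathcal{D}_x^c]$ is $P_2$-th order accurate and such that $\lim_{\theta\to0}i\theta\beta^c(\theta)=\sum_{k=-p'}^{p'}\beta^c_k=0$, and $[\mathcal{D}_{xx}^c]$ is $P_3$-th order accurate and such that $B_0=\sum_{k=-q'}^{q'}b_k<0$ (equivalently $\lim_{\theta\to0}(i\theta)^2\mathsf{b}(\theta)=B_0<0$). Then the spatial order of accuracy of the hybrid-variable semi-discretization $$\overline{w}'_{j+1/2}+\frac{c}{h}(w_{j+1}-w_j)-\frac{\nu}{h}\left([\mathcal{D}_x^cw]_{j+1}-[\mathcal{D}_x^cw]_j\right)=0,\qquad w'_j+c[\mathcal{D}_xw]_j-\nu[\mathcal{D}_{xx}^cw]_j=0$$ of the advection-diffusion equation $w_t+cw_x-\nu w_{xx}=0$ is $\min(P_1+2,\,P_2,\,P_3+2)$. Especially, if $c=0$, the order of accuracy is $\min(P_2,\,P_3+2)$.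
   Context: The grid is uniform, $x_j=jh$; the unknowns are $w_j(t)\approx w(x_j,t)$ and $\overline{w}_{j+1/2}(t)\approx\frac1h\int_{x_j}^{x_{j+1}}w(x,t)\,dx$. The operators have the form $$[\mathcal{D}_xw]_j=\frac1h\sum_{k=-l}^{r-1}\alpha_k\overline{w}_{j+k+1/2}+\frac1h\sum_{k=-l'}^{r'}\beta_kw_{j+k},\quad [\mathcal{D}_x^cw]_j=\frac1h\sum_{k=-p}^{p-1}\alpha_k^c\overline{w}_{j+k+1/2}+\frac1h\sum_{k=-p'}^{p'}\beta_k^cw_{j+k},$$ $$[\mathcal{D}_{xx}^cw]_j=\frac1{h^2}\sum_{k=-q}^{q-1}a_k\overline{w}_{j+k+1/2}+\frac1{h^2}\sum_{k=-q'}^{q'}b_kw_{j+k},$$ with real constants independent of $h$ and continuous stencils: $\max(0,l-1)\le l'\le l$, $\max(0,r-1)\le r'\le r$, $l+r+l'+r'\ge1$, $\max(0,p-1)\le p'\le p$, $p+p'\ge1$, $\max(0,q-1)\le q'\le q$, $q+q'\ge1$. Order of the operators ($P_1,P_2,P_3\ge1$ integers): for every $C^\infty$ function $w(x)$, evaluating the operators on exact nodal values and exact cell averages (denoted $w^\star$), $[\mathcal{D}_xw^\star]_j=w'(x_j)+c_1w^{(P_1+1)}(x_j)h^{P_1}+O(h^{P_1+1})$, $[\mathcal{D}_x^cw^\star]_j=w'(x_j)+c_2w^{(P_2+1)}(x_j)h^{P_2}+O(h^{P_2+2})$, $[\mathcal{D}_{xx}^cw^\star]_j=w''(x_j)+c_3w^{(P_3+2)}(x_j)h^{P_3}+O(h^{P_3+2})$,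 with nonzero constants $c_1,c_2,c_3$ independent of $w$ and $h$. Symbols: $\beta^c(\theta)=\frac{1}{i\theta}\sum_{k=-p'}^{p'}\beta_k^ce^{ik\theta}$, $\mathsf{b}(\theta)=\frac{1}{(i\theta)^2}\sum_{k=-q'}^{q'}b_ke^{ik\theta}$. Spatial order of accuracy of the method: for a fixed wave number $\kappa\in\mathbb{R}\setminus\{0\}$, put $\theta=\kappa h$ and consider the exact simple wave $w(x,t)=e^{i\kappa(x-ct)-\nu\kappa^2t}$. The semi-discrete system ($j\in\mathbb{Z}$), started from the exact nodal values and exact cell averages of $e^{i\kappa x}$, has the solution $w_j(t)=N(t)e^{ij\theta}$, $\overline{w}_{j+1/2}(t)=\frac{1}{i\theta}A(t)e^{ij\theta}(e^{i\theta}-1)$ with scalar functions $A,N$, $A(0)=N(0)=1$ (the exact solution corresponds to $A(t)=N(t)=e^{-ic\kappa t-\nu\kappa^2t}$). The method has spatial order of accuracy $P$ if, for fixed $\kappa$ and $t$, as $h\to0$, $$A(t)=e^{-ic\kappa t-\nu\kappa^2t}\left(1+O(\theta^P)\right),\qquad N(t)=e^{-ic\kappa t-\nu\kappa^2t}\left(1+O(\theta^P)\right).$$ *)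

(* Defs.v *)
From Stdlib Require Export Reals ZArith.
From Coquelicot Require Export Coquelicot.

Open Scope R_scope.

(** [sum_Z F lo hi] is the sum of [F k] over [lo <= k <= hi], hence [zero] when
    [hi < lo]. *)
Definition sum_Z {V : ModuleSpace R_Ring} (F : Z -> V) (lo hi : Z) : V :=
  sum_n_m (fun i : nat => F (lo - 1 + Z.of_nat i)%Z) 1 (Z.to_nat (hi - lo + 1)).

(** Hybrid-variable difference operators.  [op_l], [op_r] (resp. [op_l'],
    [op_r']) are the extents of the stencil on the cell averages (resp. on the
    nodal values); only the values of [op_alpha] on [-op_l .. op_r - 1] and of
    [op_beta] on [-op_l' .. op_r'] matter. *)
Record hv_operator := HVOperator {
  op_l : nat;  op_r : nat;  op_l' : nat;  op_r' : nat;
  op_alpha : Z -> R;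
  op_beta : Z -> R
}.

(** The truncated subtraction on [nat] renders [max (0, l - 1)]. *)
Definition continuous_stencil (D : hv_operator) : Prop :=
  (op_l D - 1 <= op_l' D <= op_l D)%nat /\
  (op_r D - 1 <= op_r' D <= op_r D)%nat /\
  (1 <= op_l D + op_r D + op_l' D + op_r' D)%nat.

Definition central_stencil (D : hv_operator) : Prop :=
  op_l D = op_r D /\ op_l' D = op_r' D.

(** The operator [D] scaled by [1 / h ^ m], at node [j].  Half-integer indices
    are shifted: [wbar j] stands for the cell average on
    [[x_j, x_(j+1)]], usually indexed by [j + 1/2].  The values may
    be real (consistency) or complex (simple waves). *)
Definition hv_apply {V : ModuleSpace R_Ring} (D : hv_operator) (m : nat) (h : R)
    (wbar w : Z -> V) (j : Z) : V :=
  plus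
    (scal (/ h ^ m)
       (sum_Z (fun k => scal (op_alpha D k) (wbar (j + k)%Z))
          (- Z.of_nat (op_l D)) (Z.of_nat (op_r D) - 1)))
    (scal (/ h ^ m)
       (sum_Z (fun k => scal (op_beta D k) (w (j + k)%Z))
          (- Z.of_nat (op_l' D)) (Z.of_nat (op_r' D)))).

Definition beta_sum (D : hv_operator) : R :=
  @sum_Z R_ModuleSpace (op_beta D) (- Z.of_nat (op_l' D)) (Z.of_nat (op_r' D)).

Definition smooth (f : R -> R) : Prop := forall n x, ex_derive_n f n x.

Definition nodal (f : R -> R) (h : R) (j : Z) : R := f (IZR j * h).

Definition cell_average (f : R -> R) (h : R) (j : Z) : R :=
  / h * RInt f (IZR j * h) (IZR (j + 1) * h).

(** [D], scaled by [1 / h ^ m], approximates the [m]-th derivative with leading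
    error [gamma * f^(P+m) * h^P] and remainder [O(h^(P+s))].  The [O] is
    pointwise: [h -> 0] along the grids that have the fixed point [x] as a
    node. *)
Definition accurate (D : hv_operator) (m P s : nat) : Prop :=
  exists gamma : R, gamma <> 0 /\
  forall f : R -> R, smooth f -> forall x : R,
  exists K delta : R, 0 < delta /\
  forall (h : R) (j : Z), 0 < h < delta -> IZR j * h = x ->
    Rabs (hv_apply D m h (cell_average f h) (nodal f h) j
          - Derive_n f m x - gamma * Derive_n f (P + m) x * h ^ P)
    <= K * h ^ (P + s).

Definition Cexp (z : C) : C := (exp (Re z) * cos (Im z), exp (Re z) * sin (Im z)).

(** The initial-value problem is posed for [t >= 0]; the two-sided derivative at
    [t = 0] only asks the solution to be extended differentiably to the left. *)
Definition semidiscrete_solution (Dx Dxc Dxxc : hv_operator) (c nu h : R)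
    (wbar w : Z -> R -> C) : Prop :=
  forall (j : Z) (t : R), 0 <= t ->
  let Wbar := fun k => wbar k t in
  let W := fun k => w k t in
  is_derive (wbar j) t
    (- (c / h)%R * (W (j + 1)%Z - W j)
     + (nu / h)%R * (hv_apply Dxc 1 h Wbar W (j + 1)%Z
                     - hv_apply Dxc 1 h Wbar W j))%C /\
  is_derive (w j) t
    (- c * hv_apply Dx 1 h Wbar W j + nu * hv_apply Dxxc 2 h Wbar W j)%C.

Definition simple_wave (Dx Dxc Dxxc : hv_operator) (c nu kappa h : R)
    (A N : R -> C) : Prop :=
  let theta := (kappa * h)%R in
  A 0 = RtoC 1 /\ N 0 = RtoC 1 /\
  semidiscrete_solution Dx Dxc Dxxc c nu h
    (fun j t => / (Ci * theta) * A t * Cexp (Ci * (IZR j * theta)%R)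
                * (Cexp (Ci * theta) - 1))%C
    (fun j t => N t * Cexp (Ci * (IZR j * theta)%R))%C.

Definition exact_amplitude (c nu kappa t : R) : C :=
  Cexp (- (Ci * (c * kappa * t)%R) - (nu * kappa ^ 2 * t)%R)%C.

(** "[A(t) = N(t) = exact * (1 + O(theta^P))]" for fixed [kappa] and [t]. *)
Definition spatial_order (Dx Dxc Dxxc : hv_operator) (c nu : R) (P : nat) : Prop :=
  forall kappa : R, kappa <> 0 ->
  (forall h, 0 < h ->
     exists A N : R -> C, simple_wave Dx Dxc Dxxc c nu kappa h A N) /\
  forall t : R, 0 <= t ->
  exists K delta : R, 0 < delta /\
  forall h, 0 < h < delta ->
  forall A N : R -> C, simple_wave Dx Dxc Dxxc c nu kappa h A N ->
    Cmod (A t / exact_amplitude c nu kappa t - 1)%C <= K * Rabs (kappa * h) ^ P /\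
    Cmod (N t / exact_amplitude c nu kappa t - 1)%C <= K * Rabs (kappa * h) ^ P.

(* Main.v *)
Require Import Defs.
From Stdlib Require Import Lra Lia.

(** On a simple wave the scheme reduces to a 2 x 2 linear system for (A, N).
    Divide by the exact amplitude and use u = A, v = N - A as unknowns (both
    divided).  Consistency says that the symbols of each operator on averages
    and on nodes sum to the exact symbol up to O(h^P), so that
    u' = eps u + om v and v' = mu v + r u with eps = O(h^P2), om = O(1) because
    the nodal coefficients of Dxc sum to zero, r = O(c h^P1 + h^P2 + h^P3), and
    mu = nu B0 / h^2 (1 + O(h)).  As B0 < 0, the component v is strongly damped
    and its forcing r u gains a factor h^2; energy estimates with Gronwall's
    inequality then give v = O(h^2 r) and u - 1 = O(eps) + O(v). *)

(** * Calculus of complex-valued functions of a real variable *)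

Lemma is_derive_C_parts (f : R -> C) (t : R) (l : C) :
  is_derive f t l <->
  is_derive (fun s => Re (f s)) t (Re l) /\ is_derive (fun s => Im (f s)) t (Im l).
Proof.
  split.
  - intros Hf; split.
    + apply (filterdiff_comp f (fun z : C => fst z) _ (fun z : C => fst z) Hf).
      apply filterdiff_linear, is_linear_fst.
    + apply (filterdiff_comp f (fun z : C => snd z) _ (fun z : C => snd z) Hf).
      apply filterdiff_linear, is_linear_snd.
  - intros [Hre Him].
    apply is_derive_ext with (fun s => (Re (f s), Im (f s))).
    { intros s; now destruct (f s). }
    refine (filterdiff_ext_lin _ _ _ (filterdiff_comp_2 _ _ (fun a b : R => (a, b)) _ _
      (fun a b : R => (a, b)) Hre Him (filterdiff_linear _ _)) _).
    + apply is_linear_prod; [apply is_linear_fst | apply is_linear_snd].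
    + intros y; reflexivity.
Qed.

Lemma is_derive_Cconst (a : C) (t : R) : is_derive (fun _ : R => a) t (RtoC 0).
Proof. apply is_derive_C_parts; split; apply @is_derive_const. Qed.

Lemma is_derive_Cplus (f g : R -> C) (t : R) (f' g' : C) :
  is_derive f t f' -> is_derive g t g' ->
  is_derive (fun s => (f s + g s)%C) t (f' + g')%C.
Proof. intros Hf Hg; exact (is_derive_plus _ _ _ _ _ Hf Hg). Qed.

Lemma is_derive_Cmult (f g : R -> C) (t : R) (f' g' : C) :
  is_derive f t f' -> is_derive g t g' ->
  is_derive (fun s => (f s * g s)%C) t (f' * g t + f t * g')%C.
Proof.
  intros [Hf1 Hf2]%is_derive_C_parts [Hg1 Hg2]%is_derive_C_parts.
  apply is_derive_C_parts; split.
  - refine (@eq_rect _ _ (is_derive _ t) (is_derive_minus _ _ _ _ _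
      (is_derive_mult _ _ _ _ _ Hf1 Hg1 Rmult_comm)
      (is_derive_mult _ _ _ _ _ Hf2 Hg2 Rmult_comm)) _ _).
    unfold minus, plus, opp, mult, Re, Im; simpl; ring.
  - refine (@eq_rect _ _ (is_derive _ t) (is_derive_plus _ _ _ _ _
      (is_derive_mult _ _ _ _ _ Hf1 Hg2 Rmult_comm)
      (is_derive_mult _ _ _ _ _ Hf2 Hg1 Rmult_comm)) _ _).
    unfold plus, mult, Re, Im; simpl; ring.
Qed.

Lemma is_derive_Ceq (f : R -> C) (t : R) (l l' : C) :
  is_derive f t l -> l = l' -> is_derive f t l'.
Proof. now intros H <-. Qed.

Lemma is_derive_Cscal (a : C) (f : R -> C) (t : R) (f' : C) :
  is_derive f t f' -> is_derive (fun s => (a * f s)%C) t (a * f')%C.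
Proof.
  intros Hf.
  apply (is_derive_Ceq _ _ _ _ (is_derive_Cmult _ _ _ _ _ (is_derive_Cconst a t) Hf)).
  ring.
Qed.

Lemma Cexp_scal (z : C) (t : R) :
  Cexp (z * t) = (exp (Re z * t) * cos (Im z * t), exp (Re z * t) * sin (Im z * t)).
Proof.
  destruct z as [x y]; unfold Cexp; simpl.
  now replace (x * t - y * 0) with (x * t) by ring;
    replace (x * 0 + y * t) with (y * t) by ring.
Qed.

Lemma is_derive_Cexp (z : C) (t : R) :
  is_derive (fun s : R => Cexp (z * s)) t (z * Cexp (z * t))%C.
Proof.
  apply is_derive_ext with
    (fun s => (exp (Re z * s) * cos (Im z * s), exp (Re z * s) * sin (Im z * s))).
  { intros s; symmetry; apply Cexp_scal. }
  rewrite Cexp_scal.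
  apply is_derive_C_parts; destruct z as [x y]; unfold Cmult, Re, Im; simpl.
  split; auto_derive; trivial; ring.
Qed.

Lemma Cexp_0 : Cexp 0 = 1.
Proof.
  unfold Cexp; simpl; rewrite exp_0, cos_0, sin_0; apply injective_projections; simpl; ring.
Qed.

Lemma Cexp_plus (a b : C) : Cexp (a + b) = (Cexp a * Cexp b)%C.
Proof.
  unfold Cexp, Re, Im; simpl; rewrite exp_plus, cos_plus, sin_plus.
  apply injective_projections; simpl; ring.
Qed.

Lemma Cexp_Ci (x : R) : Cexp (Ci * x) = (cos x, sin x).
Proof.
  unfold Cexp; simpl.
  replace (0 * x - 1 * 0) with 0 by ring.
  replace (0 * 0 + 1 * x) with x by ring.
  rewrite exp_0; apply injective_projections; simpl; ring.
Qed.

Lemma Cexp_neq_0 (z : C) : Cexp z <> 0.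
Proof.
  intros H; apply C1_nz.
  rewrite <- Cexp_0; replace (RtoC 0) with (z + - z)%C by ring.
  rewrite Cexp_plus, H; ring.
Qed.

Lemma Cmod_le_parts (z : C) : Cmod z <= Rabs (Re z) + Rabs (Im z).
Proof.
  replace z with (Re z + Ci * Im z)%C
    by (destruct z; apply injective_projections; simpl; ring).
  eapply Rle_trans; [apply Cmod_triangle|].
  rewrite Cmod_mult, Cmod_Ci, !Cmod_R; simpl.
  right; f_equal; [|rewrite Rmult_1_l]; f_equal; ring.
Qed.

(** The mean value theorem applied to [cos] and to [sin] separately costs one [Rabs x] for each
    component, hence the factor 2. *)
Lemma Cmod_Cexp_Ci_sub_1_le (x : R) : Cmod (Cexp (Ci * x) - 1) <= 2 * Rabs x.
Proof.
  eapply Rle_trans; [apply Cmod_le_parts|].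
  rewrite Cexp_Ci.
  replace (Re ((cos x, sin x) - 1)%C) with (cos x - 1) by reflexivity.
  replace (Im ((cos x, sin x) - 1)%C) with (sin x) by (unfold Im; simpl; ring).
  destruct (MVT_abs cos (fun s => - sin s) 0 x) as [a [Ha _]].
  { intros; apply derivable_pt_lim_cos. }
  destruct (MVT_abs sin cos 0 x) as [b [Hb _]].
  { intros; apply derivable_pt_lim_sin. }
  rewrite cos_0 in Ha; rewrite sin_0 in Hb; rewrite Rminus_0_r in Ha; rewrite !Rminus_0_r in Hb.
  rewrite Ha, Hb.
  assert (Rabs (- sin a) <= 1) by (apply Rabs_le; pose proof (SIN_bound a); lra).
  assert (Rabs (cos b) <= 1) by (apply Rabs_le; pose proof (COS_bound b); lra).
  pose proof (Rabs_pos x); nra.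
Qed.

(** * Explicit solutions of 2 x 2 linear systems *)

Lemma C_square_root (z : C) : exists s : C, (s * s)%C = z.
Proof.
  destruct z as [x y].
  set (m := sqrt (x * x + y * y)).
  assert (Hm : m * m = x * x + y * y) by (apply sqrt_sqrt; nra).
  assert (Hm0 : 0 <= m) by apply sqrt_pos.
  assert (Hp : 0 <= (m + x) / 2) by nra.
  assert (Hq : 0 <= (m - x) / 2) by nra.
  (* Half-angle formulas with [m] the modulus of [z]: [p] and [q] are the absolute values of the
     parts of the root, and the sign of [y] decides the sign of the imaginary part. *)
  set (p := sqrt ((m + x) / 2)); set (q := sqrt ((m - x) / 2)).
  assert (Hpp : p * p = (m + x) / 2) by now apply sqrt_sqrt.
  assert (Hqq : q * q = (m - x) / 2) by now apply sqrt_sqrt.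
  assert (Hp0 : 0 <= p) by apply sqrt_pos.
  assert (Hq0 : 0 <= q) by apply sqrt_pos.
  assert (Hpq : (2 * (p * q)) * (2 * (p * q)) = y * y).
  { replace ((2 * (p * q)) * (2 * (p * q))) with (4 * (p * p) * (q * q)) by ring.
    rewrite Hpp, Hqq; nra. }
  assert (H0 : 0 <= 2 * (p * q)) by nra.
  destruct (Rle_dec 0 y) as [Hy|Hy].
  - assert (H := Rsqr_inj _ _ H0 Hy Hpq).
    exists (p, q); unfold Cmult; simpl; f_equal; lra.
  - assert (H : 2 * (p * q) = - y) by (apply Rsqr_inj; unfold Rsqr; lra).
    exists (p, - q); unfold Cmult; simpl; f_equal; lra.
Qed.

(** With [s * s = d] the solutions are cosh(s t) and sinh(s t) / s; for [s = 0] they degenerate to 1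
    and t. *)
Lemma oscillator_exists (d : C) : exists f g : R -> C,
  f 0 = RtoC 1 /\ g 0 = RtoC 0 /\
  forall t, is_derive f t (d * g t)%C /\ is_derive g t (f t).
Proof.
  destruct (C_square_root d) as [s Hs].
  destruct (Ceq_dec s 0) as [H0|H0].
  - exists (fun _ => RtoC 1), (fun t => RtoC t).
    split; [reflexivity|]; split; [reflexivity|]; intros t; split.
    + subst s; rewrite <- Hs.
      apply (is_derive_Ceq _ _ _ _ (is_derive_Cconst 1 t)); ring.
    + apply is_derive_C_parts; simpl; split; auto_derive; trivial; ring.
  - exists (fun t : R => (/ 2 * (Cexp (s * t) + Cexp (- s * t)))%C),
      (fun t : R => (/ (2 * s) * (Cexp (s * t) + (-1) * Cexp (- s * t)))%C).
    split; [|split; [|intros t; split]].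
    + replace (s * 0)%C with (RtoC 0) by ring; replace (- s * 0)%C with (RtoC 0) by ring.
      rewrite Cexp_0; field.
    + replace (s * 0)%C with (RtoC 0) by ring; replace (- s * 0)%C with (RtoC 0) by ring.
      rewrite Cexp_0; field; assumption.
    + eapply is_derive_Ceq;
        [apply is_derive_Cscal, is_derive_Cplus; apply is_derive_Cexp|].
      rewrite <- Hs; field; assumption.
    + eapply is_derive_Ceq;
        [apply is_derive_Cscal, is_derive_Cplus;
         [apply is_derive_Cexp | apply is_derive_Cscal, is_derive_Cexp]|].
      field; assumption.
Qed.

(* With [T] the half trace and [S = M - T], Cayley-Hamilton gives [S^2 = d Id],
   so [exp (t M) = exp (t T) (f t Id + g t S)] for the oscillator pair [f], [g]. *)
Lemma linear_system_exists (m11 m12 m21 m22 : C) : exists A N : R -> C,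
  A 0 = RtoC 1 /\ N 0 = RtoC 1 /\
  forall t, is_derive A t (m11 * A t + m12 * N t)%C /\
            is_derive N t (m21 * A t + m22 * N t)%C.
Proof.
  set (T := ((m11 + m22) / 2)%C); set (d := ((m11 - m22) / 2)%C).
  (* The trace-free part has rows ([d], [m12]) and ([m21], [- d]), so its square is
     [d * d + m12 * m21] times the identity. The witnesses below are the exponential applied to the
     initial vector (1, 1). *)
  destruct (oscillator_exists (d * d + m12 * m21)) as (f & g & Hf0 & Hg0 & H).
  exists (fun t : R => (Cexp (T * t) * (f t + (d + m12) * g t))%C),
    (fun t : R => (Cexp (T * t) * (f t + (m21 - d) * g t))%C).
  replace (T * 0)%C with (RtoC 0) by ring.
  rewrite Cexp_0, Hf0, Hg0; split; [ring|]; split; [ring|].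
  intros t; destruct (H t) as [Hf Hg]; split.
  - eapply is_derive_Ceq;
      [apply is_derive_Cmult;
       [apply is_derive_Cexp | apply is_derive_Cplus; [exact Hf|apply is_derive_Cscal, Hg]]|].
    unfold T, d; field.
  - eapply is_derive_Ceq;
      [apply is_derive_Cmult;
       [apply is_derive_Cexp | apply is_derive_Cplus; [exact Hf|apply is_derive_Cscal, Hg]]|].
    unfold T, d; field.
Qed.

(** * Gronwall's inequality and energy estimates *)

(** The integrating factor exp(- a t) makes [phi] nonincreasing. Both signs of [a] occur later: a
    positive [a] bounds growth, a negative one exploits damping. *)
Lemma gronwall (g g' : R -> R) (a b T : R) :
  0 <= T -> a <> 0 ->
  (forall t, 0 <= t <= T -> is_derive g t (g' t) /\ g' t <= a * g t + b) ->
  g T + b / a <= (g 0 + b / a) * exp (a * T).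
Proof.
  intros HT Ha Hg.
  set (phi := fun t => (g t + b / a) * exp (- (a * t))).
  assert (Hphi : forall t, 0 <= t <= T ->
    is_derive phi t ((g' t - a * g t - b) * exp (- (a * t)))).
  { intros t Ht; destruct (Hg t Ht) as [Hd _]; unfold phi.
    auto_derive; [now exists (g' t)|].
    replace (Derive (fun x => g x) t) with (g' t) by (symmetry; now apply is_derive_unique).
    field; assumption. }
  destruct (MVT_gen phi 0 T (fun t => (g' t - a * g t - b) * exp (- (a * t))))
    as [s [Hs Hmv]].
  - intros x Hx; rewrite Rmin_left, Rmax_right in Hx by lra; apply Hphi; lra.
  - intros x Hx; rewrite Rmin_left, Rmax_right in Hx by lra.
    apply continuity_pt_filterlim, (ex_derive_continuous phi).
    eexists; apply Hphi; lra.
  - rewrite Rmin_left, Rmax_right in Hs by lra.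
    destruct (Hg s Hs) as [_ Hle].
    assert (Hdec : phi T <= phi 0).
    { pose proof (exp_pos (- (a * s))).
      assert ((g' s - a * g s - b) * exp (- (a * s)) * (T - 0) <= 0)
        by (assert (0 <= (b + a * g s - g' s) * exp (- (a * s)) * T)
              by (repeat apply Rmult_le_pos; lra); lra).
      lra. }
    unfold phi in Hdec.
    rewrite Rmult_0_r, Ropp_0, exp_0, Rmult_1_r in Hdec.
    apply Rmult_le_compat_r with (r := exp (a * T)) in Hdec; [|left; apply exp_pos].
    rewrite Rmult_assoc, <- exp_plus, Rplus_opp_l, exp_0, Rmult_1_r in Hdec.
    exact Hdec.
Qed.

Lemma exp_nondecreasing (x y : R) : x <= y -> exp x <= exp y.
Proof. intros [H|H]; [left; now apply exp_increasing | right; now f_equal]. Qed.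

(** The Euclidean inner product of the plane; it enters through the derivative of the squared
    modulus. *)
Definition Cdot (z w : C) : R := Re z * Re w + Im z * Im w.

Lemma Cdot_le (z w : C) : Cdot z w <= Cmod z * Cmod w.
Proof.
  replace (Cdot z w) with (Re (z * Cconj w)) by (unfold Cdot, Re, Im; simpl; ring).
  rewrite <- (Cmod_conj w), <- Cmod_mult.
  eapply Rle_trans; [apply Rle_abs | apply re_le_Cmod].
Qed.

Lemma Cdot_plus (z w w' : C) : Cdot z (w + w') = Cdot z w + Cdot z w'.
Proof. unfold Cdot, Re, Im; simpl; ring. Qed.

Lemma Cdot_mult_self (m z : C) : Cdot z (m * z) = Re m * Cmod z ^ 2.
Proof. rewrite Cmod2_alt; unfold Cdot, Re, Im; simpl; ring. Qed.

Lemma is_derive_Cmod2 (f : R -> C) (t : R) (l : C) :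
  is_derive f t l -> is_derive (fun s => Cmod (f s) ^ 2) t (2 * Cdot (f t) l).
Proof.
  intros [Hre Him]%is_derive_C_parts.
  apply is_derive_ext with (fun s => Re (f s) ^ 2 + Im (f s) ^ 2).
  { intros s; symmetry; apply Cmod2_alt. }
  replace (2 * Cdot (f t) l)
    with (INR 2 * Re l * Re (f t) ^ pred 2 + INR 2 * Im l * Im (f t) ^ pred 2)
    by (unfold Cdot; simpl; ring).
  apply @is_derive_plus; now apply is_derive_pow.
Qed.

Lemma pow2_le (x y : R) : 0 <= y -> x ^ 2 <= y ^ 2 -> x <= y.
Proof. intros; nra. Qed.

(* The slow component [u] stays bounded, hence the damped component [v], forced
   by [r u] only, is of size [rho / m]; this in turn controls [u - 1]. *)
Lemma damped_system_estimate (u v : R -> C) (eps om r mu : C) (e W rho m G T : R) :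
  0 <= T -> 0 < m -> Cmod eps <= e -> Cmod om <= W -> Cmod r <= rho -> Re mu <= - m ->
  0 < G -> 2 * e + W + rho <= G ->
  u 0 = RtoC 1 -> v 0 = RtoC 0 ->
  (forall t, 0 <= t -> is_derive u t (eps * u t + om * v t)%C /\
                       is_derive v t (mu * v t + r * u t)%C) ->
  let V := rho * exp (G * T) / m in
  Cmod (v T) <= V /\ Cmod (u T - 1) <= (e * exp (G * T) + W * V) * exp T.
Proof.
  intros HT Hm He HW Hr Hmu HG HeG Hu0 Hv0 Hd V.
  pose proof (Cmod_ge_0 eps); pose proof (Cmod_ge_0 om); pose proof (Cmod_ge_0 r).
  set (M := exp (G * T)).
  assert (HM : 0 < M) by apply exp_pos.
  (* Energy estimate for |u|^2 + |v|^2: the damping term is nonpositive, and the cross terms are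
     split by 2 x y <= x^2 + y^2, which gives the growth rate [G]. *)
  assert (HuM : forall t, 0 <= t <= T -> Cmod (u t) <= M).
  { intros t Ht.
    pose proof (gronwall (fun s => Cmod (u s) ^ 2 + Cmod (v s) ^ 2)
      (fun s => 2 * Cdot (u s) (eps * u s + om * v s) + 2 * Cdot (v s) (mu * v s + r * u s))
      G 0 t (proj1 Ht) (Rgt_not_eq _ _ HG)) as Hgr.
    assert (Hexp : 1 <= exp (G * t)).
    { rewrite <- exp_0; apply exp_nondecreasing; nra. }
    assert (Hexp' : exp (G * t) <= M).
    { apply exp_nondecreasing; nra. }
    apply Rle_trans with (2 := Hexp').
    apply pow2_le; [lra|].
    cbv beta in Hgr; rewrite Hu0, Hv0, Cmod_1, Cmod_0 in Hgr.
    assert (HE : Cmod (u t) ^ 2 + Cmod (v t) ^ 2 + 0 / G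
      <= (1 ^ 2 + 0 ^ 2 + 0 / G) * exp (G * t)).
    { apply Hgr; intros s Hs; destruct (Hd s (proj1 Hs)) as [Du Dv]; split.
      - apply @is_derive_plus; now apply is_derive_Cmod2.
      - cbv beta; rewrite !Cdot_plus, (Cdot_mult_self mu).
        pose proof (Cdot_le (u s) (eps * u s)) as K1; rewrite Cmod_mult in K1.
        pose proof (Cdot_le (u s) (om * v s)) as K2; rewrite Cmod_mult in K2.
        pose proof (Cdot_le (v s) (r * u s)) as K3; rewrite Cmod_mult in K3.
        set (x := Cmod (u s)) in *; set (y := Cmod (v s)) in *.
        assert (0 <= x) by apply Cmod_ge_0; assert (0 <= y) by apply Cmod_ge_0.
        assert (Cmod eps * (x * x) <= e * (x * x)) by (apply Rmult_le_compat_r; nra).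
        assert (Cmod om * (x * y) <= W * (x * y)) by (apply Rmult_le_compat_r; nra).
        assert (Cmod r * (x * y) <= rho * (x * y)) by (apply Rmult_le_compat_r; nra).
        assert (Re mu * y ^ 2 <= 0) by nra.
        assert ((W + rho) * (2 * (x * y)) <= (W + rho) * (x ^ 2 + y ^ 2))
          by (apply Rmult_le_compat_l; [lra|]; pose proof (pow2_ge_0 (x - y)); nra).
        assert ((2 * e + W + rho) * (x ^ 2 + y ^ 2) <= G * (x ^ 2 + y ^ 2))
          by (apply Rmult_le_compat_r; [nra|lra]).
        assert (0 <= e * y ^ 2) by (apply Rmult_le_pos; [lra | nra]).
        nra. }
    unfold Rdiv in HE; nra. }
  assert (HV : 0 <= V).
  { unfold V, Rdiv; fold M; repeat apply Rmult_le_pos; try lra.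
    left; now apply Rinv_0_lt_compat. }
  (* Young's inequality 2 y (rho M) <= m y^2 + (rho M)^2 / m spends half of the damping 2 m y^2 on
     the forcing. The other half leaves Gronwall with rate [- m], whose equilibrium value is V^2. *)
  assert (HvV : forall t, 0 <= t <= T -> Cmod (v t) <= V).
  { intros t Ht; apply pow2_le; [assumption|].
    pose proof (gronwall (fun s => Cmod (v s) ^ 2)
      (fun s => 2 * Cdot (v s) (mu * v s + r * u s))
      (- m) ((rho * M) ^ 2 / m) t (proj1 Ht)) as Hgr.
    cbv beta in Hgr; rewrite Hv0, Cmod_0 in Hgr.
    assert (HE : Cmod (v t) ^ 2 + (rho * M) ^ 2 / m / - m
      <= (0 ^ 2 + (rho * M) ^ 2 / m / - m) * exp (- m * t)).
    { apply Hgr; [lra|]; intros s Hs; destruct (Hd s (proj1 Hs)) as [Du Dv]; split.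
      - now apply is_derive_Cmod2.
      - cbv beta; rewrite !Cdot_plus, (Cdot_mult_self mu).
        pose proof (Cdot_le (v s) (r * u s)) as K3; rewrite Cmod_mult in K3.
        assert (HuMs : Cmod (u s) <= M) by (apply HuM; lra).
        pose proof (Cmod_ge_0 (u s)).
        set (x := Cmod (u s)) in *; set (y := Cmod (v s)) in *.
        assert (0 <= y) by apply Cmod_ge_0.
        assert (Hrx : Cmod r * x <= rho * M) by (apply Rmult_le_compat; lra).
        assert (y * (Cmod r * x) <= y * (rho * M)) by (apply Rmult_le_compat_l; lra).
        assert (Re mu * y ^ 2 <= - m * y ^ 2) by (apply Rmult_le_compat_r; nra).
        assert (Hsq : 2 * (y * (rho * M)) <= m * y ^ 2 + (rho * M) ^ 2 / m).
        { replace (m * y ^ 2 + (rho * M) ^ 2 / m)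
            with (2 * (y * (rho * M)) + m * (y - rho * M / m) ^ 2) by (field; lra).
          pose proof (pow2_ge_0 (y - rho * M / m)); nra. }
        lra. }
    replace ((rho * M) ^ 2 / m / - m) with (- V ^ 2) in HE by (unfold V, M; field; lra).
    pose proof (exp_pos (- m * t)); nra. }
  split; [apply HvV; lra|].
  (* [b] bounds the derivative of [u]. Then 2 y b <= y^2 + b^2 gives Gronwall with rate 1, and b^2
     (exp T - 1) <= (b exp T)^2. *)
  set (b := e * M + W * V).
  assert (Hb : 0 <= b) by (unfold b; apply Rplus_le_le_0_compat; apply Rmult_le_pos; lra).
  assert (HeT : 1 <= exp T) by (rewrite <- exp_0; apply exp_nondecreasing; lra).
  apply pow2_le; [apply Rmult_le_pos; lra|].
  pose proof (gronwall (fun s => Cmod (u s - 1) ^ 2)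
      (fun s => 2 * Cdot (u s - 1) (eps * u s + om * v s))
      1 (b ^ 2) T HT R1_neq_R0) as Hgr.
  cbv beta in Hgr; rewrite Hu0 in Hgr; replace (1 - 1)%C with (RtoC 0) in Hgr by ring.
  rewrite Cmod_0 in Hgr.
  assert (HE : Cmod (u T - 1) ^ 2 + b ^ 2 / 1 <= (0 ^ 2 + b ^ 2 / 1) * exp (1 * T)).
  { apply Hgr; intros s Hs; destruct (Hd s (proj1 Hs)) as [Du Dv]; split.
    - apply is_derive_Cmod2.
      apply (is_derive_Ceq _ _ _ _ (is_derive_Cplus _ _ _ _ _ Du (is_derive_Cconst (- (1)) s))).
      ring.
    - pose proof (Cdot_le (u s - 1) (eps * u s + om * v s)) as K3.
      pose proof (Cmod_triangle (eps * u s) (om * v s)) as K4; rewrite !Cmod_mult in K4.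
      assert (HuMs : Cmod (u s) <= M) by (apply HuM; lra).
      assert (HvVs : Cmod (v s) <= V) by (apply HvV; lra).
      pose proof (Cmod_ge_0 (u s)); pose proof (Cmod_ge_0 (v s)).
      assert (Cmod eps * Cmod (u s) <= e * M) by (apply Rmult_le_compat; lra).
      assert (Cmod om * Cmod (v s) <= W * V) by (apply Rmult_le_compat; lra).
      set (y := Cmod (u s - 1)) in *.
      assert (0 <= y) by apply Cmod_ge_0.
      assert (y * Cmod (eps * u s + om * v s) <= y * b)
        by (apply Rmult_le_compat_l; unfold b; lra).
      pose proof (pow2_ge_0 (y - b)); nra. }
  rewrite Rmult_1_l in HE; unfold Rdiv in HE; rewrite Rinv_1, Rmult_1_r in HE.
  fold b; nra.
Qed.

(** * Symbols of the operators on simple waves *)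

(** Two modules are allowed because the lemma serves both for complex multiplication and for the
    real-valued map [Re (z * _)]. *)
Lemma sum_Z_morphism {V V' : ModuleSpace R_Ring} (L : V -> V') (F : Z -> V) (lo hi : Z) :
  L zero = zero -> (forall x y, L (plus x y) = plus (L x) (L y)) ->
  L (sum_Z F lo hi) = sum_Z (fun k => L (F k)) lo hi.
Proof.
  intros H0 Hplus; unfold sum_Z.
  induction (Z.to_nat (hi - lo + 1)) as [|n IH].
  - now rewrite !sum_n_m_zero by lia.
  - rewrite !sum_n_Sm by lia; now rewrite Hplus, IH.
Qed.

Lemma sum_Z_ext {V : ModuleSpace R_Ring} (F G : Z -> V) (lo hi : Z) :
  (forall k, F k = G k) -> sum_Z F lo hi = sum_Z G lo hi.
Proof. intros H; apply sum_n_m_ext; intros n; apply H. Qed.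

(** The factor of [op_alpha D k] is the exact average of exp(i kappa x) over the k-th cell, with
    theta = kappa h. No power of i theta is divided out, so that [nod_symbol] tends to [beta_sum] as
    theta tends to 0. *)
Definition avg_symbol (D : hv_operator) (theta : R) : C :=
  sum_Z (fun k => op_alpha D k * (/ (Ci * theta) * Cexp (Ci * (IZR k * theta)%R)
                                  * (Cexp (Ci * theta) - 1)))%C
    (- Z.of_nat (op_l D)) (Z.of_nat (op_r D) - 1).

Definition nod_symbol (D : hv_operator) (theta : R) : C :=
  sum_Z (fun k => op_beta D k * Cexp (Ci * (IZR k * theta)%R))%C
    (- Z.of_nat (op_l' D)) (Z.of_nat (op_r' D)).

Lemma Cexp_wave_shift (j k : Z) (theta : R) :
  Cexp (Ci * (IZR (j + k) * theta)%R)
  = (Cexp (Ci * (IZR j * theta)%R) * Cexp (Ci * (IZR k * theta)%R))%C.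
Proof.
  rewrite <- Cexp_plus, plus_IZR; f_equal.
  apply injective_projections; simpl; ring.
Qed.

(** Shifting a wave by k cells only multiplies it by exp(i k theta), so the dependence on [j]
    factors out of both sums. *)
Lemma hv_apply_wave (D : hv_operator) (m : nat) (h theta : R) (A N : C) (j : Z) :
  hv_apply D m h
    (fun k => / (Ci * theta) * A * Cexp (Ci * (IZR k * theta)%R) * (Cexp (Ci * theta) - 1))%C
    (fun k => N * Cexp (Ci * (IZR k * theta)%R))%C j
  = ((/ h ^ m)%R * (Cexp (Ci * (IZR j * theta)%R)
       * (A * avg_symbol D theta + N * nod_symbol D theta)))%C.
Proof.
  set (E := Cexp (Ci * (IZR j * theta)%R)).
  assert (HL : forall (a : C) (F : Z -> C) (lo hi : Z),
    sum_Z (fun k => a * F k)%C lo hi = (a * sum_Z F lo hi)%C).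
  { intros a F lo hi; symmetry.
    apply (sum_Z_morphism (V := C_R_ModuleSpace) (V' := C_R_ModuleSpace) (Cmult a)).
    - apply Cmult_0_r.
    - intros; apply Cmult_plus_distr_l. }
  assert (Havg : (E * A * avg_symbol D theta)%C
    = sum_Z (fun k => scal (op_alpha D k) (/ (Ci * theta) * A
        * Cexp (Ci * (IZR (j + k) * theta)%R) * (Cexp (Ci * theta) - 1))%C)
      (- Z.of_nat (op_l D)) (Z.of_nat (op_r D) - 1)).
  { unfold avg_symbol; rewrite <- HL; apply sum_Z_ext; intros k.
    rewrite scal_R_Cmult, Cexp_wave_shift; fold E.
    (* The equality is stated in the carrier of a module; it is recast in [C] for [ring]. *)
    match goal with |- @eq _ ?x ?y => change (@eq C x y) end; ring. }
  assert (Hnod : (E * N * nod_symbol D theta)%C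
    = sum_Z (fun k => scal (op_beta D k) (N * Cexp (Ci * (IZR (j + k) * theta)%R))%C)
      (- Z.of_nat (op_l' D)) (Z.of_nat (op_r' D))).
  { unfold nod_symbol; rewrite <- HL; apply sum_Z_ext; intros k.
    rewrite scal_R_Cmult, Cexp_wave_shift; fold E.
    match goal with |- @eq _ ?x ?y => change (@eq C x y) end; ring. }
  unfold hv_apply; rewrite !scal_R_Cmult, <- Havg, <- Hnod.
  match goal with |- @eq _ (plus ?x ?y) ?z => change (@eq C (x + y)%C z) end; ring.
Qed.

(** * Consistency expressed through symbols *)

(** Accuracy speaks of real functions, so waves are tested through real parts. The free complex
    factor [z] keeps the family closed under differentiation and selects the real or imaginary part
    of the symbol error. *)
Definition wave_re (kappa : R) (z : C) (x : R) : R := Re (z * Cexp (Ci * (kappa * x)%R)).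

Lemma is_derive_wave_re (kappa : R) (z : C) (x : R) :
  is_derive (wave_re kappa z) x (wave_re kappa (z * (Ci * kappa)) x).
Proof.
  assert (H := is_derive_Cscal z _ _ _ (is_derive_Cexp (Ci * kappa) x)).
  apply is_derive_C_parts in H; destruct H as [H _].
  unfold wave_re; rewrite RtoC_mult.
  replace (z * (Ci * kappa) * Cexp (Ci * (kappa * x)))%C
    with (z * (Ci * kappa * Cexp (Ci * kappa * x)))%C
    by (rewrite !Cmult_assoc; reflexivity).
  revert H; apply is_derive_ext; intros s.
  now rewrite RtoC_mult, Cmult_assoc.
Qed.

Lemma Derive_n_wave_re (kappa : R) (z : C) (n : nat) (x : R) :
  Derive_n (wave_re kappa z) n x = wave_re kappa (z * (Ci * kappa) ^ n) x.
Proof.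
  revert x; induction n as [|n IH]; intros x; simpl.
  - now rewrite Cmult_1_r.
  - rewrite (Derive_ext _ _ x IH), (is_derive_unique _ _ _ (is_derive_wave_re _ _ _)).
    f_equal; ring.
Qed.

Lemma smooth_wave_re (kappa : R) (z : C) : smooth (wave_re kappa z).
Proof.
  intros [|n] x; [exact I|]; simpl.
  apply ex_derive_ext with (wave_re kappa (z * (Ci * kappa) ^ n)).
  - intros; symmetry; apply Derive_n_wave_re.
  - eexists; apply is_derive_wave_re.
Qed.

Lemma Ci_mult_neq_0 (x : R) : x <> 0 -> (Ci * x)%C <> 0.
Proof.
  intros H E; apply H; apply (f_equal Im) in E; unfold Im in E; simpl in E; lra.
Qed.

Lemma cell_average_wave_re (kappa h : R) (z : C) (k : Z) :
  kappa <> 0 -> 0 < h ->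
  cell_average (wave_re kappa z) h k
  = Re (z * (/ (Ci * (kappa * h)%R) * Cexp (Ci * (IZR k * (kappa * h))%R)
             * (Cexp (Ci * (kappa * h)%R) - 1)))%C.
Proof.
  intros Hk Hh.
  assert (Hkc : (Ci * kappa)%C <> 0) by now apply Ci_mult_neq_0.
  unfold cell_average.
  assert (HI : is_RInt (wave_re kappa z) (IZR k * h) (IZR (k + 1) * h)
    (wave_re kappa (z / (Ci * kappa)) (IZR (k + 1) * h)
     - wave_re kappa (z / (Ci * kappa)) (IZR k * h))).
  (* The antiderivative stays in the family: divide [z] by i kappa. *)
  { apply (is_RInt_derive (wave_re kappa (z / (Ci * kappa)))); intros x _.
    - replace z with (z / (Ci * kappa) * (Ci * kappa))%C at 2 by (field; split;
        [intros E; apply Hk; now apply RtoC_inj | apply Ci_nz]).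
      apply is_derive_wave_re.
    - apply (ex_derive_continuous (wave_re kappa z)); eexists; apply is_derive_wave_re. }
  rewrite (is_RInt_unique _ _ _ _ HI).
  unfold wave_re; unfold Rminus; rewrite <- re_opp, <- re_plus, <- re_scal_l; f_equal.
  replace (kappa * (IZR k * h)) with (IZR k * (kappa * h)) by ring.
  replace (kappa * (IZR (k + 1) * h)) with (IZR (k + 1) * (kappa * h)) by ring.
  rewrite Cexp_wave_shift, Rmult_1_l, !RtoC_mult, RtoC_inv by lra.
  field; repeat split; try apply Ci_nz; intros E; apply RtoC_inj in E; lra.
Qed.

Lemma hv_apply_wave_re (D : hv_operator) (m : nat) (kappa h : R) (z : C) :
  kappa <> 0 -> 0 < h ->
  hv_apply D m h (cell_average (wave_re kappa z) h) (nodal (wave_re kappa z) h) 0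
  = Re (z * ((/ h ^ m)%R * (avg_symbol D (kappa * h) + nod_symbol D (kappa * h))))%C.
Proof.
  intros Hk Hh.
  assert (HL : forall (F : Z -> C) (lo hi : Z), Re (z * sum_Z F lo hi)%C
    = sum_Z (fun k => Re (z * F k)%C : R_ModuleSpace) lo hi).
  { intros F lo hi.
    apply (sum_Z_morphism (V := C_R_ModuleSpace) (V' := R_ModuleSpace) (fun w : C => Re (z * w)%C)).
    - change (Re (z * RtoC 0)%C = 0); now rewrite Cmult_0_r.
    - intros x y; change (Re (z * (x + y))%C = Re (z * x)%C + Re (z * y)%C).
      now rewrite Cmult_plus_distr_l, re_plus. }
  replace (z * ((/ h ^ m)%R * (avg_symbol D (kappa * h) + nod_symbol D (kappa * h))))%C
    with ((/ h ^ m)%R * (z * avg_symbol D (kappa * h) + z * nod_symbol D (kappa * h)))%C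
    by ring.
  rewrite re_scal_l, re_plus; unfold avg_symbol, nod_symbol; rewrite !HL.
  unfold hv_apply.
  match goal with |- plus (scal ?a ?x) (scal ?a ?y) = ?z =>
    change (a * x + a * y = z) end.
  rewrite <- Rmult_plus_distr_l; f_equal.
  apply f_equal2; apply sum_Z_ext; intros k.
  - rewrite cell_average_wave_re by assumption.
    match goal with |- scal ?a ?x = _ => change (scal a x) with (a * x) end.
    rewrite <- re_scal_l; f_equal; rewrite Z.add_0_l; ring.
  - unfold nodal, wave_re; rewrite Z.add_0_l.
    match goal with |- scal ?a ?x = _ => change (scal a x) with (a * x) end.
    rewrite <- re_scal_l; f_equal.
    replace (kappa * (IZR k * h)) with (IZR k * (kappa * h)) by ring; ring.
Qed.

Lemma accurate_wave_re (D : hv_operator) (m P s : nat) (kappa : R) (z : C) :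
  accurate D m P s -> kappa <> 0 ->
  exists K delta : R, 0 <= K /\ 0 < delta /\ forall h, 0 < h < delta ->
  Rabs (Re (z * ((/ h ^ m)%R * (avg_symbol D (kappa * h) + nod_symbol D (kappa * h))
                 - (Ci * kappa) ^ m))%C) <= K * h ^ P.
Proof.
  intros (gamma & _ & H) Hk.
  destruct (H _ (smooth_wave_re kappa z) 0) as (K & delta & Hdelta & HK).
  set (d := gamma * Derive_n (wave_re kappa z) (P + m) 0) in *.
  (* The leading term contributes [Rabs d]. For the remainder, [h < 1] gives h^(P+s) <= h^P, and
     [Rabs K] allows for a negative [K]. *)
  exists (Rabs K + Rabs d), (Rmin delta 1).
  split; [pose proof (Rabs_pos K); pose proof (Rabs_pos d); lra|].
  split; [apply Rmin_pos; lra|].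
  intros h [Hh0 Hh]; pose proof (Rmin_l delta 1); pose proof (Rmin_r delta 1).
  assert (Hhd : 0 < h < delta) by lra.
  specialize (HK h 0%Z Hhd (Rmult_0_l h)).
  rewrite hv_apply_wave_re, Derive_n_wave_re in HK by assumption.
  unfold wave_re in HK; rewrite Rmult_0_r, Cmult_0_r, Cexp_0, Cmult_1_r in HK.
  unfold Cminus; rewrite Cmult_plus_distr_l, re_plus.
  replace (z * - (Ci * kappa) ^ m)%C with (- (z * (Ci * kappa) ^ m))%C by ring.
  rewrite re_opp.
  assert (HhP : 0 < h ^ P) by now apply pow_lt.
  assert (Hhs : 0 <= h ^ s <= 1).
  { split; [apply pow_le; lra|]. rewrite <- (pow1 s); apply pow_incr; lra. }
  rewrite pow_add in HK.
  assert (K * (h ^ P * h ^ s) <= Rabs K * h ^ P).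
  { pose proof (Rle_abs K); pose proof (Rabs_pos K).
    assert (0 <= h ^ P * h ^ s <= h ^ P) by nra.
    apply Rle_trans with (Rabs K * (h ^ P * h ^ s)).
    - apply Rmult_le_compat_r; lra.
    - apply Rmult_le_compat_l; lra. }
  match goal with |- Rabs (?x + - ?y) <= _ =>
    replace (x + - y) with ((x - y - d * h ^ P) + d * h ^ P) by ring end.
  eapply Rle_trans; [apply Rabs_triang|].
  rewrite Rabs_mult, (Rabs_pos_eq (h ^ P)) by lra.
  rewrite Rmult_plus_distr_r; apply Rplus_le_compat_r; lra.
Qed.

Lemma accurate_symbol (D : hv_operator) (m P s : nat) (kappa : R) :
  accurate D m P s -> kappa <> 0 ->
  exists K delta : R, 0 <= K /\ 0 < delta /\ forall h, 0 < h < delta ->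
  Cmod ((/ h ^ m)%R * (avg_symbol D (kappa * h) + nod_symbol D (kappa * h))
        - (Ci * kappa) ^ m) <= K * h ^ P.
Proof.
  intros HD Hk.
  (* The factors 1 and - i extract the real and the imaginary part of the symbol error. *)
  destruct (accurate_wave_re D m P s kappa 1 HD Hk) as (K1 & d1 & HK1 & Hd1 & H1).
  destruct (accurate_wave_re D m P s kappa (- Ci) HD Hk) as (K2 & d2 & HK2 & Hd2 & H2).
  exists (K1 + K2), (Rmin d1 d2); split; [lra|]; split; [now apply Rmin_pos|].
  intros h Hh; pose proof (Rmin_l d1 d2); pose proof (Rmin_r d1 d2).
  specialize (H1 h ltac:(lra)); specialize (H2 h ltac:(lra)).
  revert H1 H2; match goal with |- context [Cmod ?w] => generalize w end; intros w H1 H2.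
  replace (Re (1 * w)%C) with (Re w) in H1 by (now rewrite Cmult_1_l).
  replace (Re (- Ci * w)%C) with (Im w) in H2 by (unfold Re, Im; simpl; ring).
  eapply Rle_trans; [apply Cmod_le_parts | lra].
Qed.

(** Each exp(i k theta) is within 2 |k theta| of 1; these bounds are added up by induction on the
    length of the stencil. *)
Lemma nod_symbol_lipschitz (D : hv_operator) :
  exists L : R, 0 <= L /\ forall theta, Cmod (nod_symbol D theta - beta_sum D) <= L * Rabs theta.
Proof.
  unfold nod_symbol, beta_sum, sum_Z; set (lo := (- Z.of_nat (op_l' D))%Z).
  induction (Z.to_nat (Z.of_nat (op_r' D) - lo + 1)) as [|n [L [HL IH]]].
  - exists 0; split; [lra|]; intros theta; rewrite !sum_n_m_zero by lia.
    change (Cmod (0 - 0) <= 0 * Rabs theta).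
    replace (0 - 0)%C with (RtoC 0) by ring; rewrite Cmod_0; lra.
  - set (k := (lo - 1 + Z.of_nat (S n))%Z).
    exists (L + Rabs (op_beta D k) * (2 * Rabs (IZR k))); split.
    { pose proof (Rabs_pos (op_beta D k)); pose proof (Rabs_pos (IZR k)); nra. }
    intros theta; specialize (IH theta); rewrite !sum_n_Sm by lia; fold k.
    match goal with |- Cmod (?x - RtoC ?y) <= _ =>
      match x with plus ?a ?b => match y with plus ?c ?d =>
        replace (x - RtoC y)%C with ((a - RtoC c) + (b - RtoC d))%C end end end.
    + eapply Rle_trans; [apply Cmod_triangle|].
      rewrite Rmult_plus_distr_r; apply Rplus_le_compat; [exact IH|].
      replace (op_beta D k * Cexp (Ci * (IZR k * theta)%R) - op_beta D k)%C
        with (op_beta D k * (Cexp (Ci * (IZR k * theta)%R) - 1))%C by ring.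
      rewrite Cmod_mult, Cmod_R, Rmult_assoc; apply Rmult_le_compat_l; [apply Rabs_pos|].
      rewrite Rmult_assoc, <- Rabs_mult; apply Cmod_Cexp_Ci_sub_1_le.
    + match goal with |- _ = (?x - RtoC (plus ?c ?d))%C =>
        change (plus c d) with (c + d)%R end.
      rewrite RtoC_plus.
      match goal with |- @eq _ _ (plus ?c ?d - _)%C =>
        change (plus c d) with (c + d)%C end.
      ring.
Qed.

(** * Reduction of the scheme to a system for the amplitudes *)

Lemma is_derive_Cext (f g : R -> C) (t : R) (l l' : C) :
  (forall s, f s = g s) -> l = l' -> is_derive f t l -> is_derive g t l'.
Proof. intros Hfg <-; now apply is_derive_ext. Qed.

(** The flux difference and the cell average share the factor exp(i theta) - 1; cancelling it leaves
    i theta / h = i kappa in front. *)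
Definition avg_rate (Dxc : hv_operator) (c nu kappa h : R) (A N : C) : C :=
  (Ci * kappa * (- c * N + nu * ((/ h ^ 1)%R
     * (A * avg_symbol Dxc (kappa * h) + N * nod_symbol Dxc (kappa * h)))))%C.

Definition nod_rate (Dx Dxxc : hv_operator) (c nu kappa h : R) (A N : C) : C :=
  (- c * ((/ h ^ 1)%R
     * (A * avg_symbol Dx (kappa * h) + N * nod_symbol Dx (kappa * h)))
   + nu * ((/ h ^ 2)%R
     * (A * avg_symbol Dxxc (kappa * h) + N * nod_symbol Dxxc (kappa * h))))%C.

Section Simple_wave.

Variables (Dx Dxc Dxxc : hv_operator) (c nu kappa h : R).
Hypotheses (kappa_neq_0 : kappa <> 0) (h_pos : 0 < h).

Let theta := kappa * h.

Let theta_neq_0 : (Ci * theta)%C <> 0.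
Proof. apply Ci_mult_neq_0; unfold theta; nra. Qed.

Lemma semidiscrete_rates (A N : R -> C) (j : Z) (t : R) :
  let Wbar k := (/ (Ci * theta) * A t * Cexp (Ci * (IZR k * theta)%R)
                 * (Cexp (Ci * theta) - 1))%C in
  let W k := (N t * Cexp (Ci * (IZR k * theta)%R))%C in
  (- (c / h)%R * (W (j + 1)%Z - W j)
     + (nu / h)%R * (hv_apply Dxc 1 h Wbar W (j + 1)%Z - hv_apply Dxc 1 h Wbar W j))%C
  = (/ (Ci * theta) * (Cexp (Ci * (IZR j * theta)%R) * (Cexp (Ci * theta) - 1))
     * avg_rate Dxc c nu kappa h (A t) (N t))%C /\
  (- c * hv_apply Dx 1 h Wbar W j + nu * hv_apply Dxxc 2 h Wbar W j)%C
  = (Cexp (Ci * (IZR j * theta)%R) * nod_rate Dx Dxxc c nu kappa h (A t) (N t))%C.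
Proof.
  intros Wbar W; unfold Wbar, W; rewrite !hv_apply_wave, Cexp_wave_shift, Rmult_1_l.
  unfold avg_rate, nod_rate; fold theta; split; [|ring].
  unfold theta; rewrite !RtoC_mult, !RtoC_div, pow_1, RtoC_inv by lra.
  field; repeat split; try apply Ci_nz; intros E; apply RtoC_inj in E; lra.
Qed.

(** Reading the scheme at node 0 suffices. Recovering [A] from the cell average divides by exp(i
    theta) - 1, hence the condition on theta. *)
Lemma simple_wave_rates (A N : R -> C) (t : R) :
  Cexp (Ci * theta) <> 1 ->
  simple_wave Dx Dxc Dxxc c nu kappa h A N -> 0 <= t ->
  is_derive A t (avg_rate Dxc c nu kappa h (A t) (N t)) /\
  is_derive N t (nod_rate Dx Dxxc c nu kappa h (A t) (N t)).
Proof.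
  intros HE (_ & _ & Hs) Ht.
  assert (HE' : (Cexp (Ci * theta) - 1)%C <> 0) by now apply Cminus_eq_contra.
  destruct (Hs 0%Z t Ht) as [HA HN]; fold theta in HA, HN.
  destruct (semidiscrete_rates A N 0 t) as [EA EN].
  rewrite EA in HA; rewrite EN in HN.
  replace (Cexp (Ci * (0 * theta)%R)) with (RtoC 1) in HA, HN
    by (rewrite Rmult_0_l, Cmult_0_r, Cexp_0; reflexivity).
  split.
  - apply (is_derive_Cscal (Ci * theta / (Cexp (Ci * theta) - 1))) in HA.
    assert (Hth : RtoC theta <> 0)
      by (intros E; apply theta_neq_0; rewrite E; apply Cmult_0_r).
    revert HA; apply is_derive_Cext; [intros s|];
      field; (split; [exact Hth | split; [exact Ci_nz | exact HE']]).
  - revert HN; apply is_derive_Cext; [intros s|]; ring.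
Qed.

(** The rates are linear in (A, N), so their values at (1, 0) and (0, 1) are the columns of the
    system matrix. The wave factor is multiplied in rather than divided out, so exp(i theta) = 1 is
    covered too. *)
Lemma simple_wave_exists : exists A N, simple_wave Dx Dxc Dxxc c nu kappa h A N.
Proof.
  destruct (linear_system_exists
    (avg_rate Dxc c nu kappa h 1 0) (avg_rate Dxc c nu kappa h 0 1)
    (nod_rate Dx Dxxc c nu kappa h 1 0) (nod_rate Dx Dxxc c nu kappa h 0 1))
    as (A & N & HA0 & HN0 & HAN).
  exists A, N; split; [assumption|]; split; [assumption|]; intros j t _.
  destruct (HAN t) as [HA HN]; fold theta.
  destruct (semidiscrete_rates A N j t) as [EA EN]; cbv beta zeta.
  rewrite EA, EN; split.
  - apply (is_derive_Cscal (/ (Ci * theta)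
      * (Cexp (Ci * (IZR j * theta)%R) * (Cexp (Ci * theta) - 1)))) in HA.
    revert HA; apply is_derive_Cext; [intros s; ring|].
    f_equal; unfold avg_rate; ring.
  - apply (is_derive_Cscal (Cexp (Ci * (IZR j * theta)%R))) in HN.
    revert HN; apply is_derive_Cext; [intros s; ring|].
    f_equal; unfold nod_rate; ring.
Qed.

End Simple_wave.

(** * The normalised system and the size of its coefficients *)

Definition growth (c nu kappa : R) : C := (- c * (Ci * kappa) + nu * (Ci * kappa) ^ 2)%C.

Lemma exact_amplitude_growth (c nu kappa t : R) :
  exact_amplitude c nu kappa t = Cexp (growth c nu kappa * t).
Proof.
  unfold exact_amplitude, growth; f_equal.
  apply injective_projections; simpl; ring.
Qed.

Definition symbol_error (D : hv_operator) (m : nat) (kappa h : R) : C :=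
  ((/ h ^ m)%R * (avg_symbol D (kappa * h) + nod_symbol D (kappa * h)) - (Ci * kappa) ^ m)%C.

(** The coefficient of N - A once N = A + (N - A) is inserted into [avg_rate]. *)
Definition coupling (Dxc : hv_operator) (c nu kappa h : R) : C :=
  (Ci * kappa * (- c + nu * ((/ h ^ 1)%R * nod_symbol Dxc (kappa * h))))%C.

(** The diagonal entry for N - A; its first term behaves like nu B0 / h^2 with B0 =
    [beta_sum Dxxc]. *)
Definition damping (Dx Dxc Dxxc : hv_operator) (c nu kappa h : R) : C :=
  (nu * ((/ h ^ 2)%R * nod_symbol Dxxc (kappa * h))
   - c * ((/ h ^ 1)%R * nod_symbol Dx (kappa * h))
   - coupling Dxc c nu kappa h - growth c nu kappa)%C.

Definition avg_defect (Dxc : hv_operator) (nu kappa h : R) : C :=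
  (Ci * kappa * (nu * symbol_error Dxc 1 kappa h))%C.

(** Both amplitude equations have the exact rate [growth] up to symbol errors, so it cancels in the
    difference and only the errors force N - A. *)
Definition defect (Dx Dxc Dxxc : hv_operator) (c nu kappa h : R) : C :=
  (- c * symbol_error Dx 1 kappa h + nu * symbol_error Dxxc 2 kappa h
   - avg_defect Dxc nu kappa h)%C.

(* Normalising by the exact amplitude and passing to the difference [N - A]
   isolates the stiff part [nu * B0 / h ^ 2] in a diagonal entry. *)
Lemma normalized_system (Dx Dxc Dxxc : hv_operator) (c nu kappa h : R) (A N : R -> C) (t : R) :
  kappa <> 0 -> 0 < h -> Cexp (Ci * (kappa * h)%R) <> 1 ->
  simple_wave Dx Dxc Dxxc c nu kappa h A N -> 0 <= t ->
  let E t := Cexp (- growth c nu kappa * RtoC t) in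
  let u t := (A t * E t)%C in
  let v t := ((N t - A t) * E t)%C in
  is_derive u t (avg_defect Dxc nu kappa h * u t + coupling Dxc c nu kappa h * v t)%C /\
  is_derive v t (damping Dx Dxc Dxxc c nu kappa h * v t
                 + defect Dx Dxc Dxxc c nu kappa h * u t)%C.
Proof.
  intros Hk Hh HE Hs Ht E u v.
  destruct (simple_wave_rates _ _ _ _ _ _ _ Hk Hh _ _ _ HE Hs Ht) as [HA HN].
  assert (HEd : is_derive E t (- growth c nu kappa * E t)%C) by apply is_derive_Cexp.
  split.
  - generalize (is_derive_Cmult _ _ _ _ _ HA HEd); apply is_derive_Cext; [reflexivity|].
    unfold u, v, avg_rate, avg_defect, symbol_error, coupling, growth; ring.
  - assert (HD := is_derive_Cplus _ _ _ _ _ HN (is_derive_Cscal (- (1)) _ _ _ HA)).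
    generalize (is_derive_Cmult _ _ _ _ _ HD HEd).
    apply is_derive_Cext; [intros s; unfold v; ring|].
    unfold u, v, avg_rate, nod_rate, defect, damping, avg_defect, symbol_error, coupling, growth.
    ring.
Qed.

Lemma Cexp_Ci_neq_1 (x : R) : x <> 0 -> Rabs x <= 1 -> Cexp (Ci * x) <> 1.
Proof.
  intros H0 H1 E; rewrite Cexp_Ci in E; apply (f_equal snd) in E; simpl in E.
  (* This gives 3 < pi, so [sin] does not vanish at [x]. *)
  pose proof PI2_3_2; apply Rabs_le_between in H1.
  destruct (Rtotal_order x 0) as [Hx|[Hx|Hx]]; [|lra|].
  - pose proof (sin_gt_0 (- x)) as Hs; rewrite sin_neg in Hs; lra.
  - pose proof (sin_gt_0 x); lra.
Qed.

Lemma pow_le_pow_of_le_1 (h : R) (m n : nat) : 0 < h <= 1 -> (m <= n)%nat -> h ^ n <= h ^ m.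
Proof.
  intros Hh Hmn; replace n with (m + (n - m))%nat by lia; rewrite pow_add.
  assert (0 < h ^ m) by now apply pow_lt.
  assert (h ^ (n - m) <= 1) by (rewrite <- (pow1 (n - m)); apply pow_incr; lra).
  nra.
Qed.

Lemma Cmod_nod_symbol_le (D : hv_operator) (L kappa h : R) :
  (forall theta, Cmod (nod_symbol D theta - beta_sum D) <= L * Rabs theta) -> 0 < h ->
  Cmod (nod_symbol D (kappa * h)) <= Rabs (beta_sum D) + L * Rabs kappa * h.
Proof.
  intros HL Hh; specialize (HL (kappa * h)); rewrite Rabs_mult, (Rabs_pos_eq h) in HL by lra.
  replace (nod_symbol D (kappa * h))
    with (beta_sum D + (nod_symbol D (kappa * h) - beta_sum D))%C by ring.
  eapply Rle_trans; [apply Cmod_triangle|]; rewrite Cmod_R; lra.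
Qed.

(** With zero nodal sum, [nod_symbol] is O(h), which compensates the factor 1 / h. *)
Lemma Cmod_coupling_le (Dxc : hv_operator) (c nu L kappa h : R) :
  (forall theta, Cmod (nod_symbol Dxc theta - beta_sum Dxc) <= L * Rabs theta) ->
  beta_sum Dxc = 0 -> 0 < nu -> 0 < h ->
  Cmod (coupling Dxc c nu kappa h) <= Rabs kappa * (Rabs c + nu * L * Rabs kappa).
Proof.
  intros HL H0 Hnu Hh; apply (Cmod_nod_symbol_le _ _ kappa h) in HL; [|assumption].
  rewrite H0, Rabs_R0, Rplus_0_l in HL.
  unfold coupling; rewrite !Cmod_mult, Cmod_Ci, Rmult_1_l, Cmod_R.
  apply Rmult_le_compat_l; [apply Rabs_pos|].
  eapply Rle_trans; [apply Cmod_triangle|].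
  rewrite Cmod_opp, !Cmod_mult, !Cmod_R, (Rabs_pos_eq nu) by lra.
  apply Rplus_le_compat_l; rewrite Rmult_assoc; apply Rmult_le_compat_l; [lra|].
  rewrite pow_1, Rabs_pos_eq by (left; now apply Rinv_0_lt_compat).
  apply Rmult_le_reg_l with h; [assumption|].
  rewrite <- Rmult_assoc, Rinv_r, Rmult_1_l by lra; lra.
Qed.

Lemma Re_damping_le (Dx Dxc Dxxc : hv_operator) (c nu kappa : R) :
  beta_sum Dxc = 0 -> 0 < nu -> beta_sum Dxxc < 0 ->
  exists delta, 0 < delta /\ forall h, 0 < h < delta ->
  Re (damping Dx Dxc Dxxc c nu kappa h) <= - (- nu * beta_sum Dxxc / 2 / h ^ 2).
Proof.
  intros H0 Hnu HB.
  destruct (nod_symbol_lipschitz Dx) as (L1 & HL1 & HD1).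
  destruct (nod_symbol_lipschitz Dxc) as (L2 & HL2 & HD2).
  destruct (nod_symbol_lipschitz Dxxc) as (L3 & HL3 & HD3).
  set (W := Rabs kappa * (Rabs c + nu * L2 * Rabs kappa)).
  set (l := Cmod (growth c nu kappa)).
  set (b := Rabs c * (Rabs (beta_sum Dx) + L1 * Rabs kappa)).
  (* After multiplication by h^2 the main term is nu B0 = - 2 s, with [s] as set below, and for h <=
     1 all the rest is at most h G. Small [h] makes h G <= s, so half of the main term survives. *)
  set (G := nu * (L3 * Rabs kappa) + b + W + l).
  pose proof (Rabs_pos kappa); pose proof (Rabs_pos c); pose proof (Rabs_pos (beta_sum Dx)).
  assert (0 <= W).
  { unfold W; apply Rmult_le_pos; [lra|]; apply Rplus_le_le_0_compat; [lra|].
    repeat apply Rmult_le_pos; lra. }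
  assert (0 <= l) by apply Cmod_ge_0.
  assert (0 <= b).
  { unfold b; apply Rmult_le_pos; [lra|]; apply Rplus_le_le_0_compat; [lra|].
    apply Rmult_le_pos; lra. }
  assert (0 <= L3 * Rabs kappa) by (apply Rmult_le_pos; lra).
  assert (0 <= nu * (L3 * Rabs kappa)) by (apply Rmult_le_pos; lra).
  assert (HG : 0 <= G) by (unfold G; lra).
  set (s := - nu * beta_sum Dxxc / 2).
  assert (Hs : 0 < s) by (unfold s; nra).
  exists (Rmin 1 (s / (G + 1))); split.
  { apply Rmin_pos; [lra|]; apply Rdiv_lt_0_compat; lra. }
  intros h [Hh Hhd]; pose proof (Rmin_l 1 (s / (G + 1))); pose proof (Rmin_r 1 (s / (G + 1))).
  assert (HhG : h * (G + 1) < s).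
  { apply Rmult_lt_reg_r with (/ (G + 1)); [apply Rinv_0_lt_compat; lra|].
    rewrite Rmult_assoc, Rinv_r by lra; unfold Rdiv in *; lra. }
  assert (Hx : Re (nod_symbol Dxxc (kappa * h)) <= beta_sum Dxxc + L3 * Rabs kappa * h).
  { specialize (HD3 (kappa * h)); rewrite Rabs_mult, (Rabs_pos_eq h) in HD3 by lra.
    eapply Rle_trans in HD3; [|apply re_le_Cmod].
    unfold Cminus in HD3; rewrite re_plus, re_opp, re_RtoC in HD3.
    apply Rabs_le_between in HD3; lra. }
  assert (Hb : Cmod (c * ((/ h ^ 1)%R * nod_symbol Dx (kappa * h))) <= b * / h).
  { apply (Cmod_nod_symbol_le _ _ kappa h) in HD1; [|assumption].
    rewrite !Cmod_mult, !Cmod_R, pow_1, (Rabs_pos_eq (/ h))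
      by (left; now apply Rinv_0_lt_compat).
    unfold b; rewrite Rmult_assoc; apply Rmult_le_compat_l; [lra|].
    rewrite Rmult_comm; apply Rmult_le_compat_r; [left; now apply Rinv_0_lt_compat|].
    assert (L1 * Rabs kappa * h <= L1 * Rabs kappa * 1).
    { apply Rmult_le_compat_l; [apply Rmult_le_pos; lra | lra]. }
    lra. }
  assert (HW : Cmod (coupling Dxc c nu kappa h) <= W) by now apply Cmod_coupling_le.
  unfold damping, Cminus; rewrite !re_plus, !re_opp, !re_scal_l.
  apply (Rle_trans _ _ _ (re_le_Cmod _)) in Hb, HW.
  pose proof (re_le_Cmod (growth c nu kappa)) as Hl; fold l in Hl.
  rewrite !re_scal_l in Hb.
  apply Rabs_le_between in Hb, HW, Hl.
  assert (Hh2 : 0 < h ^ 2) by now apply pow_lt.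
  apply Rmult_le_reg_l with (h ^ 2); [assumption|].
  replace (h ^ 2 * - (s / h ^ 2)) with (- s) by (field; lra).
  apply Rle_trans with (h ^ 2 * (nu * (/ h ^ 2 * (beta_sum Dxxc + L3 * Rabs kappa * h))
    + b * / h + W + l)).
  { apply Rmult_le_compat_l; [lra|].
    assert (nu * (/ h ^ 2 * Re (nod_symbol Dxxc (kappa * h)))
      <= nu * (/ h ^ 2 * (beta_sum Dxxc + L3 * Rabs kappa * h))).
    { apply Rmult_le_compat_l; [lra|]; apply Rmult_le_compat_l; [|assumption].
      left; now apply Rinv_0_lt_compat. }
    lra. }
  replace (h ^ 2 * (nu * (/ h ^ 2 * (beta_sum Dxxc + L3 * Rabs kappa * h)) + b * / h + W + l))
    with (nu * beta_sum Dxxc + h * (nu * (L3 * Rabs kappa) + b) + h ^ 2 * (W + l))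
    by (field; lra).
  assert (h ^ 2 * (W + l) <= h * (W + l)) by (apply Rmult_le_compat_r; nra).
  unfold G, s in *; lra.
Qed.

(** * Assembly of the error estimate *)

(** The alternative [a = 0] is applied with a = |c|: it discards the error of [Dx] when there is no
    advection. *)
Lemma pow_error_le (h a K : R) (P Q : nat) :
  0 < h <= 1 -> 0 <= a -> 0 <= K -> a = 0 \/ (P <= Q)%nat -> a * K * h ^ Q <= a * K * h ^ P.
Proof.
  intros Hh Ha HK [->|H]; [lra|].
  apply Rmult_le_compat_l; [now apply Rmult_le_pos | now apply pow_le_pow_of_le_1].
Qed.

(** Any [P] below the relevant orders is allowed, and [c = 0] lifts the constraint from [P1], so
    both claims of the theorem are instances. *)
Lemma spatial_order_le (Dx Dxc Dxxc : hv_operator) (P1 P2 P3 s1 s2 s3 P : nat) (c nu : R) :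
  0 < nu -> accurate Dx 1 P1 s1 -> accurate Dxc 1 P2 s2 -> beta_sum Dxc = 0 ->
  accurate Dxxc 2 P3 s3 -> beta_sum Dxxc < 0 ->
  c = 0 \/ (P <= P1 + 2)%nat -> (P <= P2)%nat -> (P <= P3 + 2)%nat ->
  spatial_order Dx Dxc Dxxc c nu P.
Proof.
  intros Hnu A1 A2 Hc0 A3 HB HP1 HP2 HP3 kappa Hk.
  split; [intros h Hh; now apply simple_wave_exists|].
  intros T HT.
  destruct (accurate_symbol _ _ _ _ _ A1 Hk) as (K1 & d1 & HK1 & Hd1 & E1).
  destruct (accurate_symbol _ _ _ _ _ A2 Hk) as (K2 & d2 & HK2 & Hd2 & E2).
  destruct (accurate_symbol _ _ _ _ _ A3 Hk) as (K3 & d3 & HK3 & Hd3 & E3).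
  destruct (Re_damping_le Dx Dxc Dxxc c nu kappa Hc0 Hnu HB) as (d4 & Hd4 & Hdamp).
  destruct (nod_symbol_lipschitz Dxc) as (L & HL & HLip).
  set (W := Rabs kappa * (Rabs c + nu * L * Rabs kappa)).
  assert (Hk0 : 0 < Rabs kappa) by now apply Rabs_pos_lt.
  pose proof (Rabs_pos c) as Hcpos.
  assert (HW : 0 <= W).
  { unfold W; apply Rmult_le_pos; [lra|]; apply Rplus_le_le_0_compat; [lra|].
    repeat apply Rmult_le_pos; lra. }
  set (a2 := Rabs kappa * nu).
  assert (Ha2 : 0 <= a2) by (unfold a2; apply Rmult_le_pos; lra).
  set (KS := Rabs c * K1 + nu * K3 + a2 * K2).
  assert (0 <= Rabs c * K1) by (apply Rmult_le_pos; lra).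
  assert (0 <= nu * K3) by (apply Rmult_le_pos; lra).
  assert (0 <= a2 * K2) by (apply Rmult_le_pos; lra).
  (* This rate dominates 2 e + W + rho for every h <= 1, hence is independent of [h]; the 1 makes it
     positive. *)
  set (G := 2 * (a2 * K2) + W + KS + 1).
  set (M := exp (G * T)).
  assert (HM : 0 < M) by apply exp_pos.
  set (s := - nu * beta_sum Dxxc / 2).
  assert (Hs : 0 < s) by (unfold s; nra).
  set (KV := KS * M / s).
  set (KU := (a2 * K2 * M + W * KV) * exp T).
  (* [KU] bounds u - 1 and [KV] bounds v in units of h^P; N needs their sum since its normalised
     error is (u - 1) + v. The division converts h^P into |theta|^P. *)
  exists ((KU + KV) / Rabs kappa ^ P).
  (* The bound 1 / |kappa| keeps |theta| <= 1, so that exp(i theta) differs from 1. *)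
  set (d := Rmin (Rmin d1 d2) (Rmin (Rmin d3 d4) (Rmin 1 (/ Rabs kappa)))).
  exists d; split.
  { repeat apply Rmin_pos; try lra; now apply Rinv_0_lt_compat. }
  intros h Hh A N HAN.
  assert (Hd : d <= d1 /\ d <= d2 /\ d <= d3 /\ d <= d4 /\ d <= 1 /\ d <= / Rabs kappa).
  { unfold d; repeat split; unfold Rmin; repeat destruct Rle_dec; lra. }
  specialize (E1 h ltac:(lra)); specialize (E2 h ltac:(lra)); specialize (E3 h ltac:(lra)).
  specialize (Hdamp h ltac:(lra)); fold s in Hdamp.
  assert (HW' := Cmod_coupling_le Dxc c nu L kappa h HLip Hc0 Hnu ltac:(lra)); fold W in HW'.
  assert (Hh1 : 0 < h <= 1) by lra.
  assert (HhQ : forall Q, 0 < h ^ Q <= 1).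
  { intros Q; split; [apply pow_lt; lra|]; rewrite <- (pow1 Q); apply pow_incr; lra. }
  assert (HE : Cexp (Ci * (kappa * h)%R) <> 1).
  { apply Cexp_Ci_neq_1.
    - apply Rmult_integral_contrapositive; lra.
    - rewrite Rabs_mult, (Rabs_pos_eq h) by lra.
      rewrite <- (Rinv_r (Rabs kappa)) by lra; apply Rmult_le_compat_l; lra. }
  set (e := a2 * K2 * h ^ P2); set (rho := Rabs c * K1 * h ^ P1 + nu * K3 * h ^ P3 + e).
  assert (He : Cmod (avg_defect Dxc nu kappa h) <= e).
  { unfold avg_defect, e, a2; rewrite !Cmod_mult, Cmod_Ci, Rmult_1_l, !Cmod_R.
    rewrite (Rabs_pos_eq nu), !Rmult_assoc by lra.
    repeat (apply Rmult_le_compat_l; [lra|]); exact E2. }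
  assert (Hr : Cmod (defect Dx Dxc Dxxc c nu kappa h) <= rho).
  { unfold defect, rho, Cminus.
    eapply Rle_trans; [apply Cmod_triangle|]; rewrite Cmod_opp.
    apply Rplus_le_compat; [|exact He].
    eapply Rle_trans; [apply Cmod_triangle|].
    rewrite !Cmod_mult, Cmod_opp, !Cmod_R, (Rabs_pos_eq nu), !Rmult_assoc by lra.
    apply Rplus_le_compat; apply Rmult_le_compat_l; try lra; assumption. }
  set (m := s / h ^ 2) in *.
  destruct (HhQ 2%nat) as [Hh2 _].
  assert (Hm : 0 < m) by (apply Rdiv_lt_0_compat; assumption).
  destruct HAN as (HA0 & HN0 & HAN').
  set (E := fun t : R => Cexp (- growth c nu kappa * t)).
  assert (HE0 : E 0 = RtoC 1) by (unfold E; rewrite Cmult_0_r; apply Cexp_0).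
  destruct (damped_system_estimate
    (fun t => A t * E t)%C (fun t => (N t - A t) * E t)%C
    (avg_defect Dxc nu kappa h) (coupling Dxc c nu kappa h)
    (defect Dx Dxc Dxxc c nu kappa h) (damping Dx Dxc Dxxc c nu kappa h)
    e W rho m G T) as [HVb HUb]; try assumption.
  - unfold G, KS; lra.
  - unfold G, KS, rho, e.
    assert (Hpow : forall x Q, 0 <= x -> x * h ^ Q <= x).
    { intros x Q Hx; rewrite <- (Rmult_1_r x) at 2.
      apply Rmult_le_compat_l; [assumption | apply HhQ]. }
    pose proof (Hpow (a2 * K2) P2); pose proof (Hpow (Rabs c * K1) P1).
    pose proof (Hpow (nu * K3) P3); lra.
  - rewrite HA0, HE0; ring.
  - rewrite HA0, HN0; ring.
  - intros t Ht; apply normalized_system; try assumption; [lra|].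
    now split; [|split].
  - fold M in HVb, HUb; cbv beta in HVb, HUb.
    assert (He' : e <= a2 * K2 * h ^ P) by (apply pow_error_le; auto).
    assert (HhP : 0 <= h ^ P) by (left; apply HhQ).
    (* Dividing by m = s / h^2 supplies the two extra orders for [P1] and [P3]. *)
    assert (HV : rho * M / m <= KV * h ^ P).
    { replace (rho * M / m) with (rho * h ^ 2 * (M / s)) by (unfold m; field; lra).
      replace (KV * h ^ P) with (KS * h ^ P * (M / s)) by (unfold KV; field; lra).
      apply Rmult_le_compat_r; [left; now apply Rdiv_lt_0_compat|].
      unfold rho, KS, e; rewrite !Rmult_plus_distr_r.
      rewrite (Rmult_assoc (Rabs c * K1)), (Rmult_assoc (nu * K3)), (Rmult_assoc (a2 * K2)).
      rewrite <- !pow_add.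
      repeat apply Rplus_le_compat; apply pow_error_le; try lra; try lia.
      destruct HP1 as [->|HP1]; [left; apply Rabs_R0 | now right]. }
    assert (HU : Cmod (A T * E T - 1) <= KU * h ^ P).
    { eapply Rle_trans; [exact HUb|].
      replace (KU * h ^ P) with ((a2 * K2 * h ^ P * M + W * (KV * h ^ P)) * exp T)
        by (unfold KU; ring).
      apply Rmult_le_compat_r; [left; apply exp_pos|].
      apply Rplus_le_compat; [apply Rmult_le_compat_r | apply Rmult_le_compat_l]; lra. }
    assert (HEx : (/ exact_amplitude c nu kappa T)%C = E T).
    { rewrite exact_amplitude_growth; unfold E.
      replace (- growth c nu kappa * T)%C with (- (growth c nu kappa * T))%C by ring.
      pose proof (Cexp_neq_0 (growth c nu kappa * T)) as Hn.
      rewrite <- (Cmult_1_r (/ _)%C), <- Cexp_0.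
      replace (RtoC 0) with (growth c nu kappa * T + - (growth c nu kappa * T))%C by ring.
      rewrite Cexp_plus; field; assumption. }
    unfold Cdiv; rewrite HEx.
    replace ((KU + KV) / Rabs kappa ^ P * Rabs (kappa * h) ^ P) with (KU * h ^ P + KV * h ^ P).
    2:{ rewrite Rabs_mult, (Rabs_pos_eq h), Rpow_mult_distr by lra.
        field; apply pow_nonzero; lra. }
    assert (0 <= KV * h ^ P).
    { apply Rle_trans with (2 := HV); apply Rle_trans with (2 := HVb); apply Cmod_ge_0. }
    split; [lra|].
    replace (N T * E T - 1)%C with ((A T * E T - 1) + (N T - A T) * E T)%C by ring.
    eapply Rle_trans; [apply Cmod_triangle | lra].
Qed.

Theorem theorem3p2 (Dx Dxc Dxxc : hv_operator) (P1 P2 P3 : nat) (c nu : R) :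
  continuous_stencil Dx ->
  continuous_stencil Dxc -> central_stencil Dxc ->
  continuous_stencil Dxxc -> central_stencil Dxxc ->
  (1 <= P1)%nat -> (1 <= P2)%nat -> (1 <= P3)%nat ->
  0 < nu ->
  accurate Dx 1 P1 1 ->
  accurate Dxc 1 P2 2 -> beta_sum Dxc = 0 ->
  accurate Dxxc 2 P3 2 -> beta_sum Dxxc < 0 ->
  spatial_order Dx Dxc Dxxc c nu (Nat.min (Nat.min (P1 + 2) P2) (P3 + 2)) /\
  (c = 0 -> spatial_order Dx Dxc Dxxc c nu (Nat.min P2 (P3 + 2))).
Proof.
  intros _ _ _ _ _ _ _ _ Hnu A1 A2 Hc0 A3 HB.
  split; [|intros Hc];
    apply (spatial_order_le Dx Dxc Dxxc P1 P2 P3 1 2 2); try assumption;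
    try (right; lia); try (left; assumption); lia.
Qed.
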